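(* Let $S$ and $T$ be two countably infinite Boolean inverse $\wedge$-monoids which are $0$-simplifying and fundamental. Then the following are equivalent: (1) $S$ and $T$ are isomorphic. (2) The groups of units of $S$ and $T$ are isomorphic.
   Context: An inverse semigroup $S$ carries the natural partial order: $s\le t$ iff $s=te$ for some idempotent $e$. $E(S)$ is the semilattice of idempotents of $S$. All inverse monoids here have a zero. Elements $a,b$ are compatible if $ab^{-1}$ and $a^{-1}b$ are both idempotents. An inverse semigroup is distributive if every compatible pair of elements has a join and multiplication distributes over any binary joins that exist. A Boolean inverse monoid is a distributive inverse monoid $S$ such that $E(S)$ is a (unital) Boolean algebra; it is a Boolean inverse $\wedge$-monoid if in addition every pair of elements has a meet $a\wedge b$. An ideal $I$ of a Boolean inverse monoid is a $\vee$-ideal if $a\vee b\in I$ whenever $a,b\in I$ are compatible. $S$ is $0$-simplifying if its only $\vee$-ideals are $\{0\}$ and $S$. $S$ is fundamental if the centralizer $Z(E(S))$ of the idempotents equals $E(S)$. The group of units of $S$ is the group of invertible elements of $S$. *)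

(* Defs.v *)
From HB Require Import structures.
From mathcomp Require Import all_boot all_order.
From mathcomp Require Import boolp classical_sets cardinality.

Set Implicit Arguments.
Unset Strict Implicit.
Unset Printing Implicit Defensive.

Import Order.TTheory.
Local Open Scope classical_set_scope.
Local Open Scope group_scope.

HB.mixin Record StarMonoid_isInverse M of BaseGroup M := {
  mulgVg : forall x : M, x * x^-1 * x = x;
  mulVgV : forall x : M, x^-1 * x * x^-1 = x^-1;
  invg_unique : forall x y : M, x * y * x = x -> y * x * y = y -> y = x^-1
}.

#[short(type="inverseMonoidType")]
HB.structure Definition InverseMonoid :=
  {M of StarMonoid_isInverse M & StarMonoid M}.

(* The involution axioms of [starMonoidType] follow from the existence and
   uniqueness of inverses, so they add nothing to the definition. *)
HB.factory Record Monoid_isInverse M of Monoid M & BaseGroup M := {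
  mulgVg : forall x : M, x * x^-1 * x = x;
  mulVgV : forall x : M, x^-1 * x * x^-1 = x^-1;
  invg_unique : forall x y : M, x * y * x = x -> y * x * y = y -> y = x^-1
}.

HB.builders Context M of Monoid_isInverse M.

Fact invgK : involutive (@monoid.inv M).
Proof. by move=> x; apply/esym/invg_unique; [exact: mulVgV | exact: mulgVg]. Qed.

Fact idem_inv (e : M) : e * e = e -> e^-1 = e.
Proof. by move=> ee; apply/esym/invg_unique; rewrite !ee. Qed.

Fact idem_mul (e f : M) : e * e = e -> f * f = f -> e * f * (e * f) = e * f.
Proof.
move=> ee ff; set x := (e * f)^-1.
have x1 : e * f * x * (e * f) = e * f by exact: mulgVg.
have x2 : x * (e * f) * x = x by exact: mulVgV.
have xE : f * x * e = x.
  apply: invg_unique.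
    by rewrite -[RHS]x1 !mulgA -(mulgA _ f f) ff -(mulgA _ e e) ee.
  by rewrite -[in RHS]x2 !mulgA -(mulgA _ e e) ee -(mulgA _ f f) ff.
have xx : x * x = x.
  by rewrite -{1 2}xE -[RHS]xE -[in RHS]x2 !mulgA.
have xV : x = e * f by rewrite -(invgK (e * f)) -/x (idem_inv xx).
by rewrite -xV xx.
Qed.

Fact idemC (e f : M) : e * e = e -> f * f = f -> e * f = f * e.
Proof.
move=> ee ff; have efef := idem_mul ee ff; have fefe := idem_mul ff ee.
rewrite -[LHS](idem_inv efef); apply/esym/invg_unique.
  by rewrite -[RHS]efef !mulgA -(mulgA _ f f) ff -(mulgA _ e e) ee.
by rewrite -[RHS]fefe !mulgA -(mulgA _ e e) ee -(mulgA _ f f) ff.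
Qed.

Fact invgM : {morph @monoid.inv M : x y / x * y >-> y * x}.
Proof.
move=> x y.
have C : y * y^-1 * (x^-1 * x) = x^-1 * x * (y * y^-1).
  by apply: idemC; rewrite mulgA ?mulgVg ?mulVgV.
apply/esym/invg_unique.
  transitivity (x * (y * y^-1 * (x^-1 * x)) * y); first by rewrite !mulgA.
  by rewrite C !mulgA mulgVg -!mulgA (mulgA y) mulgVg.
transitivity (y^-1 * (x^-1 * x * (y * y^-1)) * x^-1); first by rewrite !mulgA.
by rewrite -C !mulgA mulVgV -!mulgA (mulgA x^-1) mulVgV.
Qed.

HB.instance Definition _ := Monoid_isStarMonoid.Build M invgK invgM.
HB.instance Definition _ :=
  StarMonoid_isInverse.Build M mulgVg mulVgV invg_unique.

HB.end.

HB.mixin Record InverseMonoid_hasZero M of InverseMonoid M := {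
  zerog : M;
  mul0g : left_zero zerog (@mul M);
  mulg0 : right_zero zerog (@mul M)
}.

#[short(type="inverseMonoid0Type")]
HB.structure Definition InverseMonoid0 :=
  {M of InverseMonoid_hasZero M & InverseMonoid M}.

Arguments zerog {s}.

Definition isomorphic (M N : baseUMagmaType) : Prop :=
  exists f : UMagmaMorphism.type M N, bijective f.

Section UnitGroup.
Variable M : inverseMonoidType.

Definition units : set M := [set x | exists y, x * y = 1 /\ y * x = 1].

Lemma units_mulgV x : units x -> x * x^-1 = 1.
Proof.
by case=> y [xy yx]; rewrite -(@invg_unique M x y) ?xy ?yx ?mul1g.
Qed.

Lemma units_mulVg x : units x -> x^-1 * x = 1.
Proof.
by case=> y [xy yx]; rewrite -(@invg_unique M x y) ?xy ?yx ?mul1g.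
Qed.

Lemma units1 : units 1.
Proof. by exists 1; rewrite mulg1. Qed.

Lemma unitsM x y : units x -> units y -> units (x * y).
Proof.
move=> [x' [xx' x'x]] [y' [yy' y'y]]; exists (y' * x'); split.
  by rewrite mulgA -(mulgA x) yy' mulg1.
by rewrite mulgA -(mulgA y') x'x mulg1.
Qed.

Lemma unitsV x : units x -> units x^-1.
Proof. by move=> Ux; exists x; rewrite units_mulgV ?units_mulVg. Qed.

Definition unit_group : Type := set_type units.

HB.instance Definition _ := Choice.copy unit_group (set_type units).

Implicit Types u v w : unit_group.

Definition unit_one : unit_group := SigSub (mem_set units1).
Definition unit_mul u v : unit_group :=
  SigSub (mem_set (unitsM (set_valP u) (set_valP v))).
Definition unit_inv u : unit_group := SigSub (mem_set (unitsV (set_valP u))).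

Lemma unit_mulA : associative unit_mul.
Proof. by move=> u v w; apply: val_inj; rewrite /= mulgA. Qed.
Lemma unit_mul1 : left_id unit_one unit_mul.
Proof. by move=> u; apply: val_inj; rewrite /= mul1g. Qed.
Lemma unit_mulr1 : right_id unit_one unit_mul.
Proof. by move=> u; apply: val_inj; rewrite /= mulg1. Qed.
Lemma unit_mulV : left_inverse unit_one unit_inv unit_mul.
Proof. by move=> u; apply: val_inj; rewrite /= units_mulVg //; exact: set_valP. Qed.
Lemma unit_mulrV : right_inverse unit_one unit_inv unit_mul.
Proof. by move=> u; apply: val_inj; rewrite /= units_mulgV //; exact: set_valP. Qed.

HB.instance Definition _ := isGroup.Build unit_group
  unit_mulA unit_mul1 unit_mulr1 unit_mulV unit_mulrV.

End UnitGroup.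

Arguments units M : clear implicits.

Section BooleanInverseMonoid.
Variable S : inverseMonoid0Type.
Implicit Types a b c e f s t : S.

Definition idempotents : set S := [set e | e * e = e].

Definition natural_le s t : Prop := exists2 e, idempotents e & s = t * e.

Definition compatible a b : Prop :=
  idempotents (a * b^-1) /\ idempotents (a^-1 * b).

Definition is_join a b c : Prop :=
  [/\ natural_le a c, natural_le b c &
      forall d, natural_le a d -> natural_le b d -> natural_le c d].

Definition is_meet a b c : Prop :=
  [/\ natural_le c a, natural_le c b &
      forall d, natural_le d a -> natural_le d b -> natural_le d c].

Definition distributive_inverse_monoid : Prop :=
  (forall a b, compatible a b -> exists c, is_join a b c) /\
  (forall a b c s, is_join a b c ->
     is_join (s * a) (s * b) (s * c) /\ is_join (a * s) (b * s) (c * s)).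

(* [ctbDistrLatticeType] is the library's structure of Boolean algebras: E(S),
   ordered by the natural partial order, is one up to order isomorphism. *)
Definition boolean_idempotents : Prop :=
  exists (d : Order.disp_t) (B : ctbDistrLatticeType d)
         (phi : idempotents -> B),
    bijective phi /\
    forall e f : idempotents,
      natural_le (val e) (val f) <-> (phi e <= phi f)%O.

Definition boolean_inverse_monoid : Prop :=
  distributive_inverse_monoid /\ boolean_idempotents.

Definition boolean_inverse_meet_monoid : Prop :=
  boolean_inverse_monoid /\ forall a b, exists c, is_meet a b c.

Definition is_ideal (I : set S) : Prop :=
  I !=set0 /\ forall a s, I a -> I (s * a) /\ I (a * s).

Definition is_join_ideal (I : set S) : Prop :=
  is_ideal I /\
  forall a b c, I a -> I b -> compatible a b -> is_join a b c -> I c.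

Definition zero_simplifying : Prop :=
  forall I : set S, is_join_ideal I -> I = [set zerog] \/ I = setT.

Definition centralizer (A : set S) : set S :=
  [set s | forall a, A a -> commute s a].

Definition fundamental : Prop := centralizer idempotents = idempotents.

End BooleanInverseMonoid.

Arguments idempotents S : clear implicits.

Definition countably_infinite (T : Type) : Prop := ([set: T] #= [set: nat])%card.

(* Main.v *)
(* The units of S act by conjugation on the Boolean algebra B of idempotents, and
   every unit has a support in B because S has meets. As S is infinite and
   0-simplifying, B is atomless, and infinitesimals (s with orthogonal domain and
   range) yield enough involutive units: every element of B is a finite join of
   supports of involutions. For an involution p, the set of units supported in
   supp p is definable in the language of groups (Fremlin, Measure Theory III,
   section 384), hence so is the inclusion between finite joins of supports of
   involutions: an isomorphism of unit groups induces an equivariant isomorphism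
   of the Boolean algebras. Every element of S is built from units and
   idempotents by products and orthogonal joins, so this isomorphism conjugates
   the action of each s in S on B to that of some t in T, which is unique since T
   is fundamental. *)
Require Import Defs.
From HB Require Import structures.
From mathcomp Require Import all_boot all_order.
From mathcomp Require Import boolp classical_sets cardinality.

Set Implicit Arguments.
Unset Strict Implicit.
Unset Printing Implicit Defensive.

Import Order.Theory.
Local Open Scope order_scope.
Local Open Scope group_scope.

(** * Groups acting on Boolean algebras with supports *)

(** The first four axioms make G a faithful group of automorphisms of B, the next two make [supp g]
    the least element off which g is trivial, and the last two supply involutions, in the spirit of
    Fremlin's groups with many involutions. *)
Record locally_moving d (B : ctbDistrLatticeType d) (G : groupType)
    (act : G -> B -> B) (supp : G -> B) : Prop := LocallyMoving {
  act1 : forall x, act 1 x = x;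
  actM : forall g h x, act (g * h) x = act g (act h x);
  act_homo : forall g x y, x <= y -> act g x <= act g y;
  act_inj : forall g h, (forall x, act g x = act h x) -> g = h;
  act_fix : forall g x, x `&` supp g = \bot -> act g x = x;
  act_moves : forall g x, x <= supp g -> x != \bot ->
    exists y, [/\ y <= x, y != \bot & y `&` act g y = \bot];
  act_restr : forall p x, p * p = 1 -> x `&` act p x = \bot ->
    exists r, (forall y, y <= x `|` act p x -> act r y = act p y) /\
      (forall y, y `&` (x `|` act p x) = \bot -> act r y = y);
  act_cover : forall x, exists ps : seq G,
    (forall p, p \in ps -> p * p = 1) /\ x = \join_(p <- ps) supp p
}.

(** * Formulas in the language of groups *)

Section GroupTerms.
Variable G : groupType.
Implicit Types g h p u v w : G.

(* When G moves points locally and p is an involution, every such u is supported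
   in supp p, and the restrictions of p to p-invariant elements are examples. *)
Definition local_involution p u := [/\ commute u p, u * u = 1 &
  forall h, commute h p -> commute u (h * u * h^-1)].

Definition local_centralizer p v := forall u, local_involution p u -> commute v u.

(* Squares of elements v as above have support disjoint from supp p, and they
   fill the complement of supp p: so this defines support inclusion. *)
Definition square_centralizer p w :=
  forall v, local_centralizer p v -> commute w (v * v).

(* Double centralizer of the elements supported in some supp p with p in ps, that
   is, the elements supported in the join of these supports. *)
Definition join_centralizer (ps : seq G) g := forall h,
  (forall p w, p \in ps -> square_centralizer p w -> commute h w) ->
  commute g h.

End GroupTerms.

(** * Invariance of these formulas under group isomorphism *)

Section GroupTermsIso.
Variables (G H : groupType) (f : UMagmaMorphism.type G H).
Hypothesis f_bij : bijective f.

Let f_inj : injective f. Proof. exact: bij_inj. Qed.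
Let f_surj h : exists g, h = f g.
Proof. by have [k _ fK] := f_bij; exists (k h). Qed.

Lemma iso_commute g h : commute (f g) (f h) <-> commute g h.
Proof.
split; last exact: gmulf_commute.
by rewrite /commute -!gmulfM => /f_inj.
Qed.

Lemma iso_local_involution p u : local_involution (f p) (f u) <-> local_involution p u.
Proof.
split=> -[up uu uh].
  split; [exact/iso_commute | by apply: f_inj; rewrite gmulfM gmulf1 |].
  move=> h hp; apply/iso_commute; rewrite !gmulfM gmulfV; apply: uh.
  exact/iso_commute.
split; [exact/iso_commute | by rewrite -gmulfM uu gmulf1 |].
move=> h' ; have [h ->] := f_surj h' => /iso_commute hp.
by rewrite -gmulfV -!gmulfM; apply/iso_commute/uh.
Qed.

Lemma iso_local_centralizer p v :
  local_centralizer (f p) (f v) <-> local_centralizer p v.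
Proof.
split=> vp.
  by move=> u /iso_local_involution/vp/iso_commute.
move=> u'; have [u ->] := f_surj u' => /iso_local_involution/vp ?.
exact/iso_commute.
Qed.

Lemma iso_square_centralizer p w :
  square_centralizer (f p) (f w) <-> square_centralizer p w.
Proof.
split=> wp.
  by move=> v /iso_local_centralizer/wp; rewrite -gmulfM => /iso_commute.
move=> v'; have [v ->] := f_surj v' => /iso_local_centralizer/wp ?.
by rewrite -gmulfM; apply/iso_commute.
Qed.

Lemma iso_join_centralizer ps g :
  join_centralizer (map f ps) (f g) <-> join_centralizer ps g.
Proof.
split=> gps h.
  move=> hps; apply/iso_commute/gps => _ w' /mapP[p pps ->].
  by have [w ->] := f_surj w' => /iso_square_centralizer/(hps _ _ pps)/iso_commute.
have [h' ->] := f_surj h => hps; apply/iso_commute/gps => p w pps.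
move=> /iso_square_centralizer wp; apply/iso_commute; apply: hps wp.
exact: map_f.
Qed.

End GroupTermsIso.

(** * Meaning of the formulas in a locally moving group *)

Section LocallyMoving.
Context d (B : ctbDistrLatticeType d) (G : groupType).
Variables (act : G -> B -> B) (supp : G -> B).
Hypothesis L : locally_moving act supp.
Implicit Types (g h p u v w : G) (x y z : B).

Let disjS x y x' y' : x' `&` y' = \bot -> x <= x' -> y <= y' -> x `&` y = \bot.
Proof. by move=> xy lx ly; apply/eqP; rewrite -lex0 -xy leI2. Qed.

Lemma splitIC x y : x = (x `&` y) `|` (x `&` ~` y).
Proof. by rewrite -meetUr joinxC meetx1. Qed.

Lemma actK g : cancel (act g) (act g^-1).
Proof. by move=> x; rewrite -(actM L) mulVg (act1 L). Qed.

Lemma actKV g : cancel (act g^-1) (act g).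
Proof. by move=> x; rewrite -(actM L) mulgV (act1 L). Qed.

Lemma act_le g x y : (act g x <= act g y) = (x <= y).
Proof.
apply/idP/idP; last exact: (act_homo L).
by move=> /(act_homo L g^-1); rewrite !actK.
Qed.

Lemma act_leV g x y : (act g^-1 x <= y) = (x <= act g y).
Proof. by rewrite -(act_le g) actKV. Qed.

Lemma act_geV g x y : (x <= act g^-1 y) = (act g x <= y).
Proof. by rewrite -(act_le g) actKV. Qed.

Lemma actI g x y : act g (x `&` y) = act g x `&` act g y.
Proof.
apply: le_anti; rewrite lexI !(act_homo L) ?leIl ?leIr //=.
rewrite -[X in X <= _](actKV g) act_le lexI.
by rewrite !act_leV leIl leIr.
Qed.

Lemma actU g x y : act g (x `|` y) = act g x `|` act g y.
Proof.
apply: le_anti; rewrite [X in _ && X]leUx !(act_homo L) ?leUl ?leUr // andbT.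
rewrite -[X in _ <= X](actKV g) act_le leUx.
by rewrite !act_geV leUl leUr.
Qed.

Lemma act0 g : act g \bot = \bot.
Proof. by apply/eqP; rewrite -lex0 -[X in _ <= X](actKV g) act_le le0x. Qed.

Lemma act_eq0 g x : (act g x == \bot) = (x == \bot).
Proof. by rewrite -[RHS](inj_eq (can_inj (actK g))) act0. Qed.

Lemma eq_act x g h : (forall y, y <= x -> act g y = act h y) ->
  (forall y, y `&` x = \bot -> act g y = act h y) -> g = h.
Proof.
move=> xgh xCgh; apply: (act_inj L) => y; rewrite (splitIC y x) !actU.
by rewrite xgh ?leIr // xCgh // -meetA [~` x `&` x]meetC meetxC meetx0.
Qed.

Lemma nbot_diff x y : ~~ (x <= y) -> x `&` ~` y != \bot.
Proof. by rewrite disj_leC complK. Qed.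

(** A part of [supp g] outside x would contain a nonzero piece that g both fixes and moves off
    itself. *)
Lemma supp_leP g x :
  supp g <= x <-> (forall y, y `&` x = \bot -> act g y = y).
Proof.
split=> [gx y yx|fix_g].
  by apply: (act_fix L); apply: (disjS yx _ gx).
apply/negPn/negP => /nbot_diff sx0.
have [y [ysx y0 ygy]] := act_moves L (leIl _ _) sx0.
move: y0; rewrite -ygy fix_g ?meetxx ?eqxx //; apply/eqP; rewrite disj_leC.
exact: le_trans ysx (leIr _ _).
Qed.

Lemma supp_eq0 g : supp g = \bot -> g = 1.
Proof.
move=> s0; apply: (act_inj L) => x; rewrite (act1 L).
by apply: (act_fix L); rewrite s0 meetx0.
Qed.

(** Otherwise all involutions in a cover of x by supports are trivial, and x is [\bot]. *)
Lemma act_local x : x != \bot -> exists2 g, g != 1 & supp g <= x.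
Proof.
move=> x0; have [ps [_ xE]] := act_cover L x; apply: contrapT => no.
move: x0; rewrite -lex0 xE => /negP; apply; apply/joinsP_seq => p pps _.
apply: contrapT => sp; apply: no; exists p.
  apply: contra_notN sp => /eqP->; apply/supp_leP => y _; exact: act1 L y.
by rewrite xE joins_sup_seq.
Qed.

(** By [act_cover], x is a join of supports; this is how [spatial_isomorphism] reads the order of B
    in the group. *)
Lemma le_suppP x y : x <= y <-> (forall g, supp g <= x -> supp g <= y).
Proof.
split=> [xy g gx|xy]; first exact: le_trans gx xy.
have [ps [_ xE]] := act_cover L x; rewrite [in X in X <= _]xE.
by apply/joinsP_seq => p pps _; apply: xy; rewrite xE joins_sup_seq.
Qed.

Lemma suppJ_le h g : supp (h * g * h^-1) <= act h (supp g).
Proof.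
apply/supp_leP => y yd; rewrite !(actM L).
rewrite [act g _](act_fix L) ?actKV //; apply: (can_inj (actK h)).
by rewrite actI actKV yd act0.
Qed.

Lemma suppJ h g : supp (h * g * h^-1) = act h (supp g).
Proof.
apply: le_anti; rewrite suppJ_le -(act_le h^-1) actK /=.
have := suppJ_le h^-1 (h * g * h^-1).
by rewrite invgK !mulgA mulVg mul1g -mulgA mulVg mulg1.
Qed.

Lemma supp_act_commute g h : commute g h -> act g (supp h) = supp h.
Proof. by rewrite -suppJ => ->; rewrite mulgK. Qed.

Lemma act_supp_le g x : x <= supp g -> act g x <= supp g.
Proof.
by move=> xg; rewrite -(supp_act_commute (commute_refl g)) act_le.
Qed.

Lemma suppV g : supp g^-1 = supp g.
Proof.
have le h : supp h^-1 <= supp h.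
  by apply/supp_leP => y yh; rewrite -[in RHS](actK h y) (act_fix L yh).
by apply: le_anti; rewrite le -{1}(invgK g) le.
Qed.

Lemma suppM g h : supp (g * h) <= supp g `|` supp h.
Proof.
apply/supp_leP => y yd; have ys z : z <= supp g `|` supp h -> y `&` z = \bot.
  by move=> zl; apply: (disjS yd _ zl).
by rewrite (actM L) !(act_fix L) ?ys ?leUl ?leUr.
Qed.

Lemma supp_sqr g : supp (g * g) <= supp g.
Proof. by rewrite -[X in _ <= X]joinxx suppM. Qed.

(** On [supp g], which g preserves, h is trivial; off [supp g], a region which h preserves, g is
    trivial. *)
Lemma commute_disj g h : supp g `&` supp h = \bot -> commute g h.
Proof.
move=> gh; apply: (@eq_act (supp g)) => y yg; rewrite !(actM L).
  rewrite ![act h _](act_fix L) //; apply: (disjS gh _ (lexx _)) => //.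
  exact: act_supp_le.
rewrite (act_fix L yg) (act_fix L) //.
have hg : act h (supp g) = supp g by apply: (act_fix L).
by rewrite -hg -actI yg act0.
Qed.

Lemma disjI_compl x y : x `&` ~` y `&` y = \bot.
Proof. by rewrite -meetA [~` y `&` y]meetC meetxC meetx0. Qed.

(* If g moves y off itself, h is supported in y and g is an involution, then
   (g * h)^2 is the product of the disjointly supported g * h * g^-1 and h. *)
Lemma exists_nontrivial_square x : x != \bot ->
  exists2 g, g * g != 1 & supp g <= x.
Proof.
move=> /act_local[g g1 gx].
have [gg|] := eqVneq (g * g) 1; last by exists g.
have s0 : supp g != \bot by apply: contra g1 => /eqP/supp_eq0/eqP.
have [y [yg y0 yd]] := act_moves L (lexx _) s0.
have [h h1 hy] := act_local y0; exists (g * h); last first.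
  by apply: le_trans (suppM _ _) _; rewrite leUx gx (le_trans hy) // (le_trans yg).
apply: contra h1 => /eqP ghgh.
have gV : g^-1 = g by apply: mulg1_eq.
have hE : h^-1 = g * h * g^-1 by apply: (@mulIg _ h); rewrite gV mulVg -ghgh !mulgA.
apply/eqP/supp_eq0/eqP; rewrite -lex0 -yd lexI hy -suppV hE suppJ act_le.
by [].
Qed.

(* On y <= x, the two sides of the commutation relation are v^-1 and v. *)
Lemma square_eq1 u v x : u * u = 1 -> x `&` act u x = \bot -> supp v <= x ->
  commute u (v * u * v^-1) -> v * v = 1.
Proof.
move=> uu ux vx cuv; suff vV : v = v^-1 by rewrite {1}vV mulVg.
have uK y : act u (act u y) = y by rewrite -(actM L) uu (act1 L).
apply: (@eq_act x) => [y yx|y yx]; last first.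
  by rewrite !(act_fix L) ?suppV //; apply: (disjS yx _ vx).
have fixu z : z <= x -> act v (act u z) = act u z /\ act v^-1 (act u z) = act u z.
  move=> zx; split; apply: (act_fix L); rewrite ?suppV meetC.
    by apply: (disjS ux vx _); rewrite act_le.
  by apply: (disjS ux vx _); rewrite act_le.
have vyx : act v^-1 y <= x.
  have [ys|] := boolP (y <= supp v).
    by apply: le_trans vx; rewrite -suppV act_supp_le ?suppV.
  rewrite (splitIC y (supp v)) => _; rewrite actU leUx; apply/andP; split.
    by apply: le_trans vx; rewrite -suppV act_supp_le // suppV leIr.
  by rewrite (act_fix L) ?suppV ?disjI_compl // (le_trans (leIl _ _)).
have := congr1 (act^~ y) cuv; rewrite /= !(actM L).
by rewrite (fixu _ yx).2 uK (fixu _ vyx).1 uK => ->.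
Qed.

(** Otherwise u moves some nonzero y outside [supp p] off itself. Any v supported in y commutes with
    p, so [square_eq1] forces v * v = 1, against [exists_nontrivial_square]. *)
Lemma local_involution_supp p u : local_involution p u -> supp u <= supp p.
Proof.
move=> [up uu uJ]; apply/negPn/negP => /nbot_diff x0.
have [y [yx y0 yd]] := act_moves L (leIl _ _) x0.
have [v /eqP vv vy] := exists_nontrivial_square y0; apply: vv.
apply: (square_eq1 uu yd vy (uJ _ _)); apply: commute_disj.
exact: (disjS (disjI_compl _ _) (le_trans vy yx) (lexx _)).
Qed.

Definition restricts p r x := [/\ act p x = x,
  forall y, y <= x -> act r y = act p y &
  forall y, y `&` x = \bot -> act r y = y].

Lemma restrictsT p : restricts p p \top.
Proof.
split=> // [|y]; last by rewrite meetx1 => ->; rewrite act0.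
by apply: le_anti; rewrite lex1 -act_leV lex1.
Qed.

Lemma restrictsJ p r x h : commute h p -> restricts p r x ->
  restricts p (h * r * h^-1) (act h x).
Proof.
move=> hp [px rx rCx]; split=> [|y yx|y yx].
- by rewrite -(actM L) -hp (actM L) px.
- rewrite !(actM L) rx ?act_leV //.
  by rewrite -(actM L) hp (actM L) actKV.
- rewrite !(actM L) rCx ?actKV //; apply: (can_inj (actK h)).
  by rewrite actI actKV yx act0.
Qed.

(** On each of the four pieces cut out by x and x', all preserved by p, each of r and r' acts either
    as p or trivially. *)
Lemma restricts_commute p r r' x x' : restricts p r x -> restricts p r' x' ->
  commute r r'.
Proof.
move=> [px rx rCx] [px' rx' rCx'].
have pl z y : act p z = z -> y <= z -> act p y <= z by move=> pz; rewrite -{2}pz act_le.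
have pd z y : act p z = z -> y `&` z = \bot -> act p y `&` z = \bot.
  by move=> pz yz; rewrite -{1}pz -actI yz act0.
apply: (@eq_act x) => y yx; rewrite !(actM L); last first.
  rewrite (rCx y yx) rCx //.
  rewrite (splitIC y x') actU rx' ?leIr // rCx' ?disjI_compl //.
  rewrite meetUl pd ?join0x //; first by apply: (disjS yx _ (lexx _)); rewrite leIl.
  by apply: (disjS yx _ (lexx _)); rewrite leIl.
rewrite (rx y yx) (splitIC y x') !actU.
set y1 := y `&` x'; set y2 := y `&` ~` x'.
have [y1x y2x] : y1 <= x /\ y2 <= x by rewrite !(le_trans (leIl _ _)).
have y1x' : y1 <= x' by rewrite leIr.
have y2x' : y2 `&` x' = \bot by exact: disjI_compl.
rewrite (rx' y1) // (rx' (act p y1)) ?pl // (rCx' y2) //.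
by rewrite (rCx' (act p y2)) ?pd // !rx ?pl.
Qed.

(** If h commutes with p, then h * r * h^-1 is again a restriction of p, and any two restrictions of
    p commute. *)
Lemma local_involution_restricts p r x :
  p * p = 1 -> restricts p r x -> local_involution p r.
Proof.
move=> pp rx; split.
- exact: restricts_commute rx (restrictsT p).
- case: rx => px rx rCx; apply: (@eq_act x) => y yx; rewrite (actM L) (act1 L).
    by rewrite !rx -?(actM L) ?pp ?(act1 L) // -px act_le.
  by rewrite !rCx.
- by move=> h hp; apply: restricts_commute rx (restrictsJ hp rx).
Qed.

Lemma exists_restricts p x : p * p = 1 -> x `&` act p x = \bot ->
  exists r, restricts p r (x `|` act p x).
Proof.
move=> pp xd; have [r [rx rCx]] := act_restr L pp xd; exists r; split=> //.
by rewrite actU -(actM L) pp (act1 L) joinC.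
Qed.

(** A part of the join outside [supp r] would be fixed by p together with everything below it,
    whereas p exchanges the disjoint x and [act p x]. *)
Lemma supp_restricts p r x : p * p = 1 -> x `&` act p x = \bot ->
  restricts p r (x `|` act p x) -> supp r = x `|` act p x.
Proof.
move=> pp xd [pD rD rCD]; apply: le_anti; apply/andP; split.
  exact/supp_leP.
apply/negPn/negP => /nbot_diff; set y := _ `&` _ => /negP; apply.
have fixr z : z <= y -> act p z = z.
  move=> zy; rewrite -rD; last by apply: le_trans zy _; rewrite leIl.
  apply: (act_fix L); apply: (disjS (disjI_compl _ _) zy (lexx _)).
have y1 : y `&` x = \bot.
  apply/eqP; rewrite -lex0 -xd lexI leIr -[X in X <= _]fixr ?leIl //.
  by rewrite act_le leIr.
have y2 : y `&` act p x = \bot.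
  apply/eqP; rewrite -lex0 -xd lexI leIr andbT -[X in X <= _]fixr ?leIl //.
  by rewrite -act_geV (mulg1_eq pp) leIr.
have yE : y `&` (x `|` act p x) = y by rewrite meet_l ?leIl.
by rewrite -yE meetUr y1 y2 joinxx.
Qed.

(** If v * v moved part of [supp p], three shrinkings would give a nonzero x disjoint from its
    images under v * v, v and p. For y <= x, v commutes with the involution exchanging y and its
    image under p, hence preserves their join. So v agrees with p on x and then takes [act p x] back
    over x, which contradicts the choice of x. *)
Lemma local_centralizer_square p v : p * p = 1 -> local_centralizer p v ->
  supp (v * v) `&` supp p = \bot.
Proof.
move=> pp vp; apply/eqP/negPn/negP => /[dup] x0.
move=> /(act_moves L (leIl _ _))[y1 [y1x y10 y1d]].
have y1v : y1 <= supp v.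
  by apply: le_trans (supp_sqr v); apply: le_trans y1x (leIl _ _).
have [y2 [y21 y20 y2d]] := act_moves L y1v y10.
have y2p : y2 <= supp p by rewrite (le_trans y21) // (le_trans y1x) ?leIr.
have [x [x2 xN0 xd]] := act_moves L y2p y20.
have {y1 y2 y1x y10 y1d y1v y2p y20 y2d x0 x2 y21}
  [xv xvv] : x `&` act v x = \bot /\ x `&` act (v * v) x = \bot.
  split; first by apply: (disjS y2d x2 _); rewrite act_le.
  by apply: (disjS y1d (le_trans x2 y21) _); rewrite act_le (le_trans x2).
have inv y : y <= x -> act v (y `|` act p y) = y `|` act p y.
  move=> yx; have yd : y `&` act p y = \bot by apply: (disjS xd yx _); rewrite act_le.
  have [r ry] := exists_restricts pp yd.
  rewrite -(supp_restricts pp yd ry); apply: supp_act_commute.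
  exact/vp/(local_involution_restricts pp ry).
have le_cancel y z t : y <= z `|` t -> y `&` z = \bot -> y <= t.
  by move=> yzt yz; rewrite -(meet_idPl yzt) meetUr yz join0x leIr.
have vle y : y <= x -> act v y <= act p y.
  move=> yx; apply: (@le_cancel _ y); first by rewrite -inv // act_le leUl.
  by rewrite meetC; apply: (disjS xv yx _); rewrite act_le.
have vE : act v x = act p x.
  (* The part z of [act p x] missed by [act v x] comes from [act p z] <= x, whose image under v lies
     both in z and in [act v x]. *)
  apply: le_anti; rewrite vle //=; apply/negPn/negP => /nbot_diff.
  set z := _ `&` _ => /negP; apply.
  have pzx : act p z <= x by rewrite -(mulg1_eq pp) act_leV leIl.
  have := vle _ pzx; rewrite -(actM L p p) pp (act1 L) => vpz.
  rewrite -(act_eq0 p) -(act_eq0 v) -lex0 -(disjI_compl (act p x) (act v x)).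
  by rewrite lexI vpz act_le.
(* As v preserves the join of x and [act p x] and sends x to [act p x], the image of [act p x] has
   to contain x. *)
move: xN0; rewrite -lex0 -xvv lexI lexx (actM L) vE /= => /negP; apply.
apply: (@le_cancel _ (act p x)) => //.
by rewrite -vE -actU vE inv // leUl.
Qed.

(** If w moves y outside [supp p] off itself, some v supported in y has a nontrivial square. This v
    commutes with all local involutions, but w cannot commute with v * v, since it would preserve
    the support of v * v. The converse is [local_centralizer_square]. *)
Lemma square_centralizerP p w : p * p = 1 ->
  square_centralizer p w <-> supp w <= supp p.
Proof.
move=> pp; split=> [wp|wp v vp].
  apply/negPn/negP => /nbot_diff x0.
  have [y [yx y0 yd]] := act_moves L (leIl _ _) x0.
  have [v /eqP vv vy] := exists_nontrivial_square y0; apply: vv.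
  apply: supp_eq0; apply/eqP; rewrite -lex0 -yd lexI.
  have le : supp (v * v) <= y := le_trans (supp_sqr v) vy.
  rewrite le -(supp_act_commute (wp v _)) ?act_le //.
  move=> u /local_involution_supp up; apply: commute_disj.
  by apply: (disjS (disjI_compl _ _) (le_trans vy yx) up).
apply: commute_disj; rewrite meetC.
exact: disjS (local_centralizer_square pp vp) (lexx _) wp.
Qed.

(** If g moves y <= x off itself, it commutes with no nontrivial h supported in y, since it would
    have to preserve [supp h]. *)
Lemma centralizer_supp x g :
  (forall h, supp h <= x -> commute g h) <-> supp g `&` x = \bot.
Proof.
split=> [gx|gx h hx]; last by apply: commute_disj; apply: (disjS gx _ hx).
apply/eqP/negPn/negP => /(act_moves L (leIl _ _))[y [yx y0 yd]].
have [h /eqP h1 hy] := act_local y0; apply: h1.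
apply: supp_eq0; apply/eqP; rewrite -lex0 -yd lexI hy.
rewrite -(supp_act_commute (gx h _)) ?act_le //.
by rewrite (le_trans hy) // (le_trans yx) ?leIr.
Qed.

(** [centralizer_supp] applies twice: the first centralizer consists of the elements supported off
    the join, the second of those supported in it. *)
Lemma join_centralizerP (ps : seq G) g : (forall p, p \in ps -> p * p = 1) ->
  join_centralizer ps g <-> supp g <= \join_(p <- ps) supp p.
Proof.
move=> pp; set x := \join_(p <- ps) supp p.
have eqC h : (forall p w, p \in ps -> square_centralizer p w -> commute h w) <->
    supp h <= ~` x.
  have xP : supp h <= ~` x <->
      forall p, p \in ps -> supp h `&` supp p = \bot.
    rewrite lexC; split=> [/joinsP_seq hx p /hx/(_ isT)|hx].
      by rewrite -disj_leC meetC => /eqP.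
    by apply/joinsP_seq => p /hx /eqP; rewrite meetC disj_leC.
  rewrite xP; split=> [hps p pps|hps p w pps].
    apply/centralizer_supp => w wp; apply: (hps _ _ pps).
    exact/(square_centralizerP _ (pp p pps)).
  move=> /(square_centralizerP _ (pp p pps)).
  exact: (@centralizer_supp (supp p) h).2 (hps p pps) w.
rewrite -[x]complK -disj_leC; split=> [gx|/eqP/centralizer_supp gx h /eqC].
  by apply/eqP/centralizer_supp => h /eqC/gx.
exact: gx.
Qed.

End LocallyMoving.

(** * Recovering the Boolean algebra and the action from the group *)

Section Spatial.
Context d d' (B : ctbDistrLatticeType d) (B' : ctbDistrLatticeType d').
Variables (G G' : groupType) (act : G -> B -> B) (supp : G -> B).
Variables (act' : G' -> B' -> B') (supp' : G' -> B').
Hypotheses (L : locally_moving act supp) (L' : locally_moving act' supp').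
Variable f : UMagmaMorphism.type G G'.
Hypothesis f_bij : bijective f.

Let matches x x' := forall g, supp g <= x <-> supp' (f g) <= x'.

Let involutions_map (ps : seq G) : (forall p, p \in ps -> p * p = 1) ->
  forall p, p \in map f ps -> p * p = 1.
Proof. by move=> pp _ /mapP[p /pp p1 ->]; rewrite -gmulfM p1 gmulf1. Qed.

Let matches_join (ps : seq G) : (forall p, p \in ps -> p * p = 1) ->
  matches (\join_(p <- ps) supp p) (\join_(p <- map f ps) supp' p).
Proof.
move=> pp g; rewrite -(join_centralizerP L g pp).
rewrite -(join_centralizerP L' _ (involutions_map pp)).
by split=> /(iso_join_centralizer f_bij).
Qed.

Let matches_le x y x' y' : matches x x' -> matches y y' -> (x' <= y') = (x <= y).
Proof.
move=> xx' yy'; apply/idP/idP => [/(le_suppP L') le|/(le_suppP L) le].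
  by apply/(le_suppP L) => g /xx'/le/yy'.
have [k _ fK] := f_bij.
by apply/(le_suppP L') => g; rewrite -(fK g) => /xx'/le/yy'.
Qed.

Let matchesJ g x x' : matches x x' -> matches (act g x) (act' (f g) x').
Proof.
move=> xx' h; rewrite -!(act_leV L) -!(act_leV L').
rewrite -(suppJ L) -gmulfV -(suppJ L') -gmulfV -!gmulfM; exact: xx'.
Qed.

(** Covers by involutions give every element a partner in both directions, and [matches_le] makes
    partners unique. Equivariance holds because acting on a support is conjugating the group
    element. *)
Theorem spatial_isomorphism : exists theta : B -> B',
  [/\ bijective theta, forall x y, (theta x <= theta y) = (x <= y) &
    forall g x, theta (act g x) = act' (f g) (theta x)].
Proof.
have /choice[theta thetaP] : forall x, exists x', matches x x'.
  move=> x; have [ps [pp ->]] := act_cover L x.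
  by exists (\join_(p <- map f ps) supp' p); exact: matches_join.
have /choice[eta etaP] : forall x', exists x, matches x x'.
  move=> x'; have [ps [pp xE]] := act_cover L' x'; have [k kK fK] := f_bij.
  have psE : map f (map k ps) = ps by rewrite -map_comp map_id_in // => p _ /=.
  exists (\join_(p <- map k ps) supp p); rewrite xE -[in X in matches _ X]psE.
  apply: matches_join => _ /mapP[p /pp p1 ->]; apply: (can_inj kK).
  by rewrite gmulfM gmulf1 fK.
have uniq x x' y' : matches x x' -> matches x y' -> x' = y'.
  move=> xx' xy'; apply: le_anti.
  by rewrite (matches_le xx' xy') (matches_le xy' xx') lexx.
have uniq' x y x' : matches x x' -> matches y x' -> x = y.
  move=> xx' yx'; apply: le_anti.
  by rewrite -(matches_le xx' yx') -(matches_le yx' xx') lexx.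
exists theta; split.
- exists eta => x; first exact: uniq' (etaP _) (thetaP x).
  exact: uniq (thetaP _) (etaP x).
- by move=> x y; exact: matches_le.
- by move=> g x; apply: uniq (thetaP _) (matchesJ g (thetaP x)).
Qed.

End Spatial.

(** * Coordinates of a Boolean inverse monoid in its algebra of idempotents *)

Section InverseMonoid.
Variable S : inverseMonoid0Type.
Implicit Types a b c e f s t : S.

Lemma idem_inv e : idempotents S e -> e^-1 = e.
Proof. by move=> ee; apply/esym/invg_unique; rewrite !ee. Qed.

Lemma idemM e f : idempotents S e -> idempotents S f -> idempotents S (e * f).
Proof.
move=> ee ff; rewrite /idempotents /= -[RHS]mulgVg invgM !idem_inv //.
by rewrite !mulgA -(mulgA _ f f) ff -(mulgA _ e e) ee.
Qed.

Lemma idemC e f : idempotents S e -> idempotents S f -> e * f = f * e.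
Proof.
by move=> ee ff; rewrite -[LHS]idem_inv ?invgM ?idem_inv //; apply: idemM.
Qed.

Lemma idem_mulV s : idempotents S (s * s^-1).
Proof. by rewrite /idempotents /= mulgA mulgVg. Qed.

Lemma idem_Vmul s : idempotents S (s^-1 * s).
Proof. by rewrite /idempotents /= mulgA mulVgV. Qed.

Lemma idemJ s e : idempotents S e -> idempotents S (s * e * s^-1).
Proof.
move=> ee; rewrite /idempotents /= -!mulgA (mulgA s^-1) (mulgA e (s^-1 * s)).
by rewrite (idemC ee (idem_Vmul s)) -!mulgA (mulgA e e) ee !mulgA mulgVg.
Qed.

Lemma natural_leP s t : natural_le s t <-> s = t * (s^-1 * s).
Proof.
split=> [[e ee ->]|->]; last by exists (s^-1 * s) => //; apply: idem_Vmul.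
rewrite invgM idem_inv // -!mulgA [in RHS](mulgA t^-1) (mulgA e) (mulgA t).
rewrite (idemC ee (idem_Vmul t)) -!mulgA ee !mulgA mulgVg.
by [].
Qed.

Lemma natural_le_refl s : natural_le s s.
Proof. by apply/natural_leP; rewrite mulgA mulgVg. Qed.

Lemma natural_le_anti s t : natural_le s t -> natural_le t s -> s = t.
Proof.
move=> [f ff sE] [e ee tE].
have tfe : t = t * f * e by rewrite -sE.
by rewrite sE {1}tfe -mulgA (idemC ee ff) !mulgA -(mulgA t) ff -tfe.
Qed.

Lemma natural_le_mull e s : idempotents S e -> natural_le (e * s) s.
Proof.
move=> ee; exists (s^-1 * e * s).
  by rewrite -{2}(invgK s); apply: idemJ.
by rewrite !mulgA -{1}(mulgVg s) !mulgA -(idemC ee (idem_mulV s)) !mulgA.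
Qed.

Lemma natural_le_idem s e : idempotents S e -> natural_le s e -> idempotents S s.
Proof. by move=> ee [f ff ->]; apply: idemM. Qed.

Lemma natural_le0 s : natural_le zerog s.
Proof. by exists zerog; rewrite ?mulg0 // /idempotents /= mulg0. Qed.

Lemma join_uniq a b c c' : is_join a b c -> is_join a b c' -> c = c'.
Proof.
by move=> [ac bc cP] [ac' bc' cP']; apply: natural_le_anti; [apply: cP|apply: cP'].
Qed.

Lemma joinr0 a : is_join a zerog a.
Proof. by split=> //; [exact: natural_le_refl|exact: natural_le0]. Qed.

Lemma joinC_is a b c : is_join a b c -> is_join b a c.
Proof. by move=> [ac bc cP]; split=> // x bx ax; apply: cP. Qed.

Lemma idem0 : idempotents S zerog. Proof. exact: mulg0. Qed.
Lemma idem1 : idempotents S 1. Proof. exact: mulg1. Qed.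

End InverseMonoid.

(** The joins in [coordU] are joins in all of S, so that distributivity of the multiplication
    applies to them. *)
Record idempotent_coords d (B : ctbDistrLatticeType d) (S : inverseMonoid0Type)
    (iota : B -> S) : Prop := IdempotentCoords {
  coord_idem : forall x, idempotents S (iota x);
  coord_surj : forall e, idempotents S e -> exists x, e = iota x;
  coord_inj : injective iota;
  coordI : forall x y, iota (x `&` y) = iota x * iota y;
  coord0 : iota \bot = zerog;
  coord1 : iota \top = 1;
  coordU : forall x y, is_join (iota x) (iota y) (iota (x `|` y))
}.

(** Products of idempotents are their meets in the natural order. Two idempotents are compatible,
    and their join in S lies below 1, hence is idempotent and is also their join in the Boolean
    algebra. *)
Lemma idempotent_coordsP (S : inverseMonoid0Type) : boolean_inverse_monoid S ->
  exists d (B : ctbDistrLatticeType d) (iota : B -> S), idempotent_coords iota.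
Proof.
move=> [[join_ex _] [d [B [phi [[psi phiK psiK] phi_le]]]]].
pose iota b : S := val (psi b); exists d, B, iota.
have iota_idem x : idempotents S (iota x) by exact: set_valP.
have iota_inj : injective iota by move=> x y /val_inj/(can_inj psiK).
have iota_surj e : idempotents S e -> exists x, e = iota x.
  by move=> ee; exists (phi (SigSub (mem_set ee))); rewrite /iota phiK.
have iota_le x y : natural_le (iota x) (iota y) <-> x <= y.
  by rewrite phi_le !psiK.
have iota_mul x y : iota x * iota y = iota (x `&` y).
  have [z zE] := iota_surj _ (idemM (iota_idem x) (iota_idem y)).
  rewrite zE; congr iota; apply: le_anti; rewrite lexI -andbA.
  apply/and3P; split; try apply/iota_le.
  - by rewrite -zE; exists (iota y).
  - by rewrite -zE; apply: natural_le_mull.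
  - apply/natural_leP; rewrite idem_inv // (iota_idem (x `&` y)) -zE.
    have /iota_le/natural_leP := leIl x y.
    rewrite idem_inv // (iota_idem (x `&` y)) => xE.
    have /iota_le/natural_leP := leIr y x.
    rewrite idem_inv // (iota_idem (x `&` y)) => yE.
    by rewrite -mulgA -yE.
split=> //.
- have [z zE] := iota_surj _ (idem0 S).
  rewrite zE; congr iota; apply: le_anti; rewrite le0x /=; apply/iota_le.
  by rewrite -zE; exact: natural_le0.
- have [z zE] := iota_surj _ (idem1 S).
  rewrite zE; congr iota; apply: le_anti; rewrite lex1 andbT; apply/iota_le.
  by rewrite -zE; exists (iota \top); rewrite ?mul1g.
move=> x y; have [|c cJ] := join_ex (iota x) (iota y).
  by split; rewrite idem_inv //; apply: idemM.
have [xc yc cP] := cJ.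
have le1 z : natural_le (iota z) 1 by exists (iota z); rewrite ?mul1g.
have [z zE] : exists z, c = iota z.
  by apply: iota_surj; apply: natural_le_idem (idem1 S) (cP _ _ _).
suff -> : x `|` y = z by rewrite -zE.
apply: le_anti; rewrite leUx -andbA; apply/and3P; split; apply/iota_le.
- by rewrite -zE.
- by rewrite -zE.
- by rewrite -zE; apply: cP; apply/iota_le; rewrite ?leUl ?leUr.
Qed.

(** Conjugation by any s, not only by a unit, read in B. Conjugates of idempotents are idempotent,
    so under [idempotent_coords] the default [\bot] is never a fallback. *)
Definition conj_act d (B : ctbDistrLatticeType d) (S : inverseMonoid0Type)
  (iota : B -> S) s x := xget \bot [set y | iota y = s * iota x * s^-1]%classic.

(** * Domains, ranges and the conjugation action of the whole monoid *)

Section Coords.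
Context d (B : ctbDistrLatticeType d) (S : inverseMonoid0Type).
Variable iota : B -> S.
Hypotheses (H : idempotent_coords iota) (S_distr : distributive_inverse_monoid S).
Implicit Types (s t a b c : S) (x y z : B).

Local Notation act := (conj_act iota).
Local Notation dom s := (act s^-1 \top).
Local Notation rng s := (act s \top).

Let iotaV x : (iota x)^-1 = iota x. Proof. exact/idem_inv/(coord_idem H). Qed.
Let iotaM x : iota x * iota x = iota x. Proof. exact: (coord_idem H). Qed.
Let iotaC x y : iota x * iota y = iota y * iota x.
Proof. by rewrite -!(coordI H) meetC. Qed.

Lemma iota_le x y : iota x * iota y = iota x <-> x <= y.
Proof.
rewrite -(coordI H) -(rwP meet_idPl); split=> [/(coord_inj H)//|->//].
Qed.

Lemma iota_act s x : iota (act s x) = s * iota x * s^-1.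
Proof.
rewrite /conj_act; case: xgetP => // no.
have [y yE] := coord_surj H (idemJ s (coord_idem H x)).
by case: (no y); rewrite /= -yE.
Qed.

Lemma iota_rng s : iota (rng s) = s * s^-1.
Proof. by rewrite iota_act (coord1 H) mulg1. Qed.

Lemma iota_dom s : iota (dom s) = s^-1 * s.
Proof. by rewrite iota_rng invgK. Qed.

Lemma mul_dom s : s * iota (dom s) = s.
Proof. by rewrite iota_dom mulgA mulgVg. Qed.

Lemma rng_mul s : iota (rng s) * s = s.
Proof. by rewrite iota_rng mulgVg. Qed.

Lemma conj_actM s t x : act (s * t) x = act s (act t x).
Proof. by apply: (coord_inj H); rewrite !iota_act invgM !mulgA. Qed.

Lemma conj_act1 x : act 1 x = x.
Proof. by apply: (coord_inj H); rewrite iota_act invg1 mul1g mulg1. Qed.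

Lemma conj_act_iota x y : act (iota x) y = x `&` y.
Proof.
by apply: (coord_inj H); rewrite iota_act iotaV (coordI H) -mulgA (iotaC y) mulgA iotaM.
Qed.

Lemma mul_iota s x : s * iota x = iota (act s x) * s.
Proof.
by rewrite iota_act -mulgA -iota_dom -mulgA (iotaC x) mulgA mul_dom.
Qed.

Lemma conj_actI s x y : act s (x `&` y) = act s x `&` act s y.
Proof.
apply: (coord_inj H); rewrite (coordI H) !iota_act (coordI H).
rewrite -!mulgA (mulgA s^-1 s) -iota_dom [in RHS](mulgA (iota x)) (iotaC x (dom s)).
by rewrite !mulgA mul_dom.
Qed.

Lemma conj_act_homo s x y : x <= y -> act s x <= act s y.
Proof. by move=> /meet_idPl <-; rewrite conj_actI leIr. Qed.

Lemma conj_actU s x y : act s (x `|` y) = act s x `|` act s y.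
Proof.
apply: (coord_inj H); apply: join_uniq (coordU H _ _); rewrite !iota_act.
by have [_ m] := S_distr; apply m; apply m; apply: coordU.
Qed.

Lemma conj_act0 s : act s \bot = \bot.
Proof. by apply: (coord_inj H); rewrite iota_act (coord0 H) mulg0 mul0g. Qed.

Lemma conj_actVK s x : act s^-1 (act s x) = dom s `&` x.
Proof. by rewrite -conj_actM -iota_dom conj_act_iota. Qed.

Lemma conj_act_le_rng s x : act s x <= rng s.
Proof. by rewrite conj_act_homo // lex1. Qed.

Lemma mul_iotaP s x : s * iota x = s <-> dom s <= x.
Proof.
split=> [sx|/iota_le dx]; last by rewrite -[in LHS](mul_dom s) -mulgA dx mul_dom.
by apply/iota_le; rewrite iota_dom -mulgA sx.
Qed.

Lemma iota_mulP s x : iota x * s = s <-> rng s <= x.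
Proof.
split=> [sx|/iota_le dx].
  by apply/iota_le; rewrite iotaC iota_rng mulgA sx.
by rewrite -[in LHS](rng_mul s) mulgA iotaC dx rng_mul.
Qed.

Lemma dom_mul_iota s x : dom (s * iota x) = dom s `&` x.
Proof.
apply: (coord_inj H); rewrite iota_dom (coordI H) invgM iotaV -mulgA.
by rewrite (mulgA s^-1) -iota_dom mulgA (iotaC x) -mulgA iotaM.
Qed.

Lemma rng_mul_iota s x : rng (s * iota x) = act s x.
Proof. by rewrite conj_actM conj_act_iota meetx1. Qed.

Lemma rng_dom s : act s (dom s) = rng s.
Proof. by rewrite -{1}(invgK s) conj_actVK meetx1 invgK. Qed.

Lemma join_mul_iota s x y : is_join (s * iota x) (s * iota y) (s * iota (x `|` y)).
Proof. by have [_ m] := S_distr; apply m; apply: coordU. Qed.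

Lemma eq_mul_iotaU s t x y : s * iota x = t * iota x -> s * iota y = t * iota y ->
  s * iota (x `|` y) = t * iota (x `|` y).
Proof.
move=> sx sy; apply: join_uniq (join_mul_iota s x y) _.
by rewrite sx sy; apply: join_mul_iota.
Qed.

Lemma eq_mul_iotaC s t x : s * iota x = t * iota x -> s * iota (~` x) = t * iota (~` x) ->
  s = t.
Proof. by move=> sx /(eq_mul_iotaU sx); rewrite joinxC (coord1 H) !mulg1. Qed.

(** Orthogonal domains and ranges make a * b^-1 and a^-1 * b zero, so a and b are compatible; c is
    their join. *)
Lemma glue a b x y : x `&` y = \bot -> dom a <= x -> dom b <= y ->
  rng a `&` rng b = \bot ->
  exists c, [/\ c * iota x = a, c * iota y = b & c * iota (x `|` y) = c].
Proof.
move=> xy ax yb ab; have [join_ex m] := S_distr.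
move: ax yb => /mul_iotaP ax /mul_iotaP byy.
have [|c cJ] := join_ex a b.
  split.
    rewrite -ax -byy invgM iotaV -!mulgA (mulgA (iota x)) -(coordI H) xy (coord0 H).
    by rewrite mul0g mulg0; apply: idem0.
  rewrite -(rng_mul a) -(rng_mul b) invgM iotaV -!mulgA (mulgA (iota _)) -(coordI H) ab.
  by rewrite (coord0 H) mul0g mulg0; apply: idem0.
have cx : c * iota x = a.
  apply: join_uniq (joinr0 a); have [_] := m a b c (iota x) cJ.
  by rewrite ax -byy -mulgA -(coordI H) meetC xy (coord0 H) mulg0.
have cy : c * iota y = b.
  apply: join_uniq (joinr0 b); have [_ /joinC_is] := m a b c (iota y) cJ.
  by rewrite byy -ax -mulgA -(coordI H) xy (coord0 H) mulg0.
exists c; split=> //; apply: join_uniq cJ.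
by rewrite -cx -cy; apply: join_mul_iota.
Qed.

Lemma join_dom a b c : is_join a b c ->
  [/\ a = c * iota (dom a), b = c * iota (dom b) & c = c * iota (dom a `|` dom b)].
Proof.
move=> cJ; have [/natural_leP ac /natural_leP bc _] := cJ.
rewrite -iota_dom in ac; rewrite -iota_dom in bc; split=> //.
by apply: join_uniq cJ _; rewrite {1}ac {1}bc; apply: join_mul_iota.
Qed.

Lemma rng_join a b c : is_join a b c -> rng c = rng a `|` rng b.
Proof.
move=> /join_dom[ac bc ->]; rewrite rng_mul_iota conj_actU.
by rewrite [in RHS]ac [in RHS]bc !rng_mul_iota.
Qed.

Lemma conj_act_dom s x : act s (dom s `&` x) = act s x.
Proof. by rewrite conj_actI rng_dom meet_r // conj_act_le_rng. Qed.

Lemma conj_act_eq0 s x : act s x = \bot -> dom s `&` x = \bot.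
Proof. by move=> s0; rewrite -conj_actVK s0 conj_act0. Qed.

Lemma rng_iota x : rng (iota x) = x.
Proof. by rewrite conj_act_iota meetx1. Qed.

Lemma commute_iota_idem s : fundamental S ->
  (forall x, s * iota x = iota x * s) -> exists x, s = iota x.
Proof.
move=> S_fund sC; apply: (coord_surj H); rewrite -S_fund => e ee.
by have [x ->] := coord_surj H ee; rewrite /commute sC.
Qed.

(** The element s^-1 * t commutes with all idempotents, so fundamentality makes it the idempotent
    [iota (dom s)]. Hence s is the restriction of t to the range of s, which is also the range of
    t. *)
Lemma conj_act_inj s t : fundamental S -> (forall x, act s x = act t x) -> s = t.
Proof.
move=> S_fund st.
have dom_le u v : (forall x, act u x = act v x) -> dom u <= dom v.
  move=> uv; rewrite -[dom v]complK -disj_leC; apply/eqP/conj_act_eq0.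
  by rewrite uv -conj_act_dom meetxC conj_act0.
have dom_eq : dom s = dom t by apply: le_anti; rewrite !dom_le.
have rng_w : rng (s^-1 * t) = dom s.
  by rewrite conj_actM -st conj_actVK meetx1.
have [|y yE] := @commute_iota_idem (s^-1 * t) S_fund.
  move=> x; rewrite mul_iota conj_actM -st conj_actVK (coordI H) iotaC -mulgA.
  by congr (_ * _); apply/iota_mulP; rewrite rng_w.
have ydom : y = dom s by rewrite -rng_w yE rng_iota.
have: iota (rng s) * t = s by rewrite iota_rng -mulgA yE ydom mul_dom.
by rewrite st rng_mul => ->.
Qed.

(** The trace on B of the join ideal generated by [iota q]. *)
Inductive covered (q : B) : B -> Prop :=
| covered_rng s : dom s <= q -> covered q (rng s)
| covered_join x y : covered q x -> covered q y -> covered q (x `|` y).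

Lemma covered_act q s x : covered q x -> covered q (act s x).
Proof.
elim=> [t tq|y z _ cy _ cz]; last by rewrite conj_actU; apply: covered_join.
rewrite -conj_actM; apply: covered_rng; rewrite invgM conj_actM.
by apply: le_trans tq; exact: conj_act_le_rng.
Qed.

(** The elements with covered range form a join ideal, nonzero as it contains [iota q]. *)
Lemma all_covered q x : zero_simplifying S -> q != \bot -> covered q x.
Proof.
move=> S_simp q0; pose I : set S := [set s | covered q (rng s)]%classic.
have Iq : I (iota q) by apply: covered_rng; rewrite iotaV rng_iota.
suff [IE|IE] : I = [set zerog]%classic \/ I = setT.
- case/negP: q0; apply/eqP/(coord_inj H); rewrite (coord0 H).
  by move: Iq; rewrite IE.
- by have : I (iota x); [rewrite IE | rewrite /I /= rng_iota].
apply: S_simp; split; first split.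
- by exists (iota q).
- move=> a s Ia; split; first by rewrite /I /= conj_actM; apply: covered_act.
  have -> : a * s = iota (rng (a * s)) * a * s.
    by rewrite -mulgA rng_mul.
  rewrite /I /= -mulgA.
  have le : rng (a * s) <= rng a by rewrite conj_actM conj_act_homo ?lex1.
  have -> : rng (iota (rng (a * s)) * (a * s)) = act (iota (rng (a * s))) (rng a).
    by rewrite rng_mul conj_act_iota meet_l.
  exact: covered_act.
- by move=> a b c Ia Ib _ /rng_join rc; rewrite /I /= rc; apply: covered_join.
Qed.

(** Every idempotent meets x in [\bot] or x, so s commutes with all idempotents and is itself
    idempotent by fundamentality. *)
Lemma atom_corner x s : fundamental S ->
  (forall y, y <= x -> y = \bot \/ y = x) -> dom s <= x -> rng s <= x ->
  s = zerog \/ s = iota x.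
Proof.
move=> S_fund xatom /mul_iotaP sx /iota_mulP xs.
have [|y yE] := @commute_iota_idem s S_fund.
  move=> y; have [] := xatom (x `&` y); rewrite ?leIl // => xy.
    rewrite -{1}sx -[in RHS]xs -mulgA (mulgA (iota y)) -!(coordI H).
    by rewrite (meetC y) xy (coord0 H) mul0g mulg0.
  by rewrite -{1}sx -[in RHS]xs -mulgA (mulgA (iota y)) -!(coordI H) (meetC y) xy sx xs.
have yx : y <= x by apply/iota_le; rewrite -yE sx.
by have [yE'|yE'] := xatom y yx; rewrite yE yE' ?(coord0 H); [left|right].
Qed.

Definition corner x y : set S := [set s | rng s <= x /\ dom s <= y]%classic.

Let some_join a b : S := xget zerog [set c | is_join a b c]%classic.

Let some_joinE a b c : is_join a b c -> some_join a b = c.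
Proof.
move=> cJ; rewrite /some_join; case: xgetP => [c' _ cJ'|/(_ c)//].
exact: join_uniq cJ' cJ.
Qed.

Lemma finite_corner_sub (x y : B) (A A' : set S) (f f' : S -> S) :
  finite_set A -> finite_set A' ->
  (forall s, corner x y s -> [/\ A (f s), A' (f' s) & is_join (f s) (f' s) s]) ->
  finite_set (corner x y).
Proof.
move=> finA finA' split_s.
apply: sub_finite_set (finite_image2 some_join finA finA') => s /split_s[sA sA' sJ].
by exists (f s) => //; exists (f' s) => //; exact: some_joinE.
Qed.

(* If q is an atom then q S q = {0, q}, as S is fundamental; the top element being
   covered by q, this shows that S would be finite. *)
Lemma finite_corner q x y : fundamental S ->
  (forall z, z <= q -> z = \bot \/ z = q) -> covered q x -> covered q y ->
  finite_set (corner x y).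
Proof.
move=> S_fund qatom cx; elim: cx y => [s sq y|x1 x2 _ fin1 _ fin2 y cy]; last first.
  apply: (finite_corner_sub (f := fun s => iota x1 * s)
    (f' := fun s => iota x2 * s) (fin1 y cy) (fin2 y cy)) => s [sx sy].
  have dom_le z : dom (iota z * s) <= y.
    by apply: le_trans sy; rewrite invgM conj_actM; apply: conj_act_le_rng.
  have rng_le z : rng (iota z * s) <= z by rewrite conj_actM conj_act_iota leIl.
  split=> //; move/iota_mulP: sx => sx; rewrite -{3}sx.
  by have [_ m] := S_distr; apply m; apply: coordU.
elim=> [t tq|y1 y2 _ fin1 _ fin2]; last first.
  apply: (finite_corner_sub (f := fun s => s * iota y1)
    (f' := fun s => s * iota y2) fin1 fin2) => u [ux uy].
  split; rewrite /corner /= ?dom_mul_iota ?leIr ?rng_mul_iota.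
  - by rewrite (le_trans _ ux) // conj_act_le_rng.
  - by rewrite (le_trans _ ux) // conj_act_le_rng.
  - by move/mul_iotaP: uy => uy; rewrite -{3}uy; apply: join_mul_iota.
(* Now u goes from [rng t] to [rng s], so u = s * w * t^-1 with w = s^-1 * u * t in the corner at q,
   which [atom_corner] describes. *)
apply: sub_finite_set (finite_image (fun w => s * w * t^-1)
  (finite_set2 zerog (iota q))) => u [/iota_mulP us /mul_iotaP ut].
exists (s^-1 * u * t); last by rewrite -[RHS]us -[in RHS]ut !iota_rng !mulgA.
apply: atom_corner => //.
  by rewrite invgM conj_actM (le_trans (conj_act_le_rng _ _)).
by rewrite -mulgA conj_actM (le_trans (conj_act_le_rng _ _)).
Qed.

(** Otherwise x is an atom covering [\top], and S, the corner at [\top], is finite by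
    [finite_corner]. *)
Lemma exists_split x : fundamental S -> zero_simplifying S ->
  ~ finite_set [set: S] -> x != \bot ->
  exists y, [/\ y <= x, y != \bot & x `&` ~` y != \bot].
Proof.
move=> S_fund S_simp S_inf x0; apply: contrapT => no; apply: S_inf.
apply: sub_finite_set (@finite_corner x \top \top _ _ _ _) => //.
- move=> y yx; have [|y0] := eqVneq y \bot; [by left|right].
  apply: le_anti; rewrite yx /= -[y]complK -disj_leC; apply/negPn/negP => xy.
  by apply: no; exists y.
- exact: all_covered.
- exact: all_covered.
Qed.

End Coords.

(** * The action of the unit group *)

Definition unit_val (S : inverseMonoidType) (g : unit_group S) : S :=
  val (g : set_type (@units S)).

Section UnitVal.
Variable S : inverseMonoidType.
Implicit Types g h : unit_group S.

Lemma unit_val_inj : injective (@unit_val S).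
Proof. by move=> g h; apply: val_inj. Qed.

Lemma unit_valM g h : unit_val (g * h) = unit_val g * unit_val h.
Proof. by []. Qed.

Lemma unit_valV g : unit_val g^-1 = (unit_val g)^-1.
Proof. by []. Qed.

Lemma unit_val1 : unit_val 1 = 1 :> S.
Proof. by []. Qed.

Lemma unit_valP g : units S (unit_val g).
Proof. exact: set_valP. Qed.

Lemma unit_val_surj x : units S x -> exists g, unit_val g = x.
Proof. by move=> ux; exists (SigSub (mem_set ux)). Qed.

Lemma unit_val_Vmul g : (unit_val g)^-1 * unit_val g = 1.
Proof. exact/units_mulVg/unit_valP. Qed.

End UnitVal.

Section UnitAction.
Context d (B : ctbDistrLatticeType d) (S : inverseMonoid0Type).
Variable iota : B -> S.
Hypotheses (H : idempotent_coords iota) (S_distr : distributive_inverse_monoid S).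
Hypothesis S_meet : forall a b : S, exists c, is_meet a b c.
Hypotheses (S_fund : fundamental S) (S_simp : zero_simplifying S).
Hypothesis S_inf : ~ finite_set [set: S].
Implicit Types (s t a b c : S) (x y z : B) (g h : unit_group S).

Local Notation act := (conj_act iota).
Local Notation dom s := (act s^-1 \top).
Local Notation rng s := (act s \top).

(** The meet of g with 1 is an idempotent, and x is its coordinate. *)
Lemma fix_ex g : exists x, forall y, unit_val g * iota y = iota y <-> y <= x.
Proof.
have [c [cg c1 cP]] := S_meet (unit_val g) 1.
have cc : idempotents S c by apply: natural_le_idem (idem1 S) c1.
have [x xE] := coord_surj H cc; exists x => y.
split=> [gy|/(iota_le H) yx].
  have : natural_le (iota y) c.
    apply: cP; exists (iota y); rewrite ?mul1g ?gy //; exact: coord_idem H y.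
  move=> /natural_leP; rewrite xE idem_inv; last exact: coord_idem H y.
  rewrite (coord_idem H y) -(coordI H) => yE; apply/(iota_le H).
  by rewrite -(coordI H) meetC -yE.
have gx : unit_val g * iota x = iota x.
  move/natural_leP: cg; rewrite xE idem_inv; last exact: coord_idem H x.
  by rewrite (coord_idem H x).
by rewrite -yx -(coordI H) meetC (coordI H) mulgA gx.
Qed.

Definition usupp g := ~` sval (cid (fix_ex g)).

Lemma fixP g y : unit_val g * iota y = iota y <-> y `&` usupp g = \bot.
Proof.
rewrite /usupp; case: cid => x /= ->; rewrite -{1}[x]complK -disj_leC.
by split=> /eqP.
Qed.

Definition uact g x := act (unit_val g) x.

Lemma uact1 x : uact 1 x = x.
Proof. exact: (conj_act1 H). Qed.

Lemma uactM g h x : uact (g * h) x = uact g (uact h x).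
Proof. exact: (conj_actM H). Qed.

Lemma uact_fix g x : x `&` usupp g = \bot -> uact g x = x.
Proof.
move=> /fixP gx; apply: (coord_inj H); rewrite (iota_act H) gx.
have iV : (iota x)^-1 = iota x by exact/idem_inv/(coord_idem H).
by rewrite -{1}iV -invgM gx iV.
Qed.

Lemma uact_inj g h : (forall x, uact g x = uact h x) -> g = h.
Proof. by move=> /(conj_act_inj H S_fund)/unit_val_inj. Qed.

(** Otherwise g fixes every y <= x. Then g * [iota x] commutes with all idempotents, so by
    fundamentality it is idempotent, hence equal to [iota x], and x is disjoint from the support. *)
Lemma uact_moves g x : x <= usupp g -> x != \bot ->
  exists y, [/\ y <= x, y != \bot & y `&` uact g y = \bot].
Proof.
move=> xg x0; apply: contrapT => no.
have small y : y <= x -> y `&` uact g y = \bot -> y = \bot.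
  by move=> yx yg; apply/eqP/negPn/negP => y0; apply: no; exists y.
have le_of y z : (y `&` ~` z) = \bot -> y <= z.
  by move=> yz; rewrite -[z]complK -disj_leC yz.
have guK y : uact g^-1 (uact g y) = y by rewrite -uactM mulVg uact1.
have guVK y : uact g (uact g^-1 y) = y by rewrite -uactM mulgV uact1.
have mono h y z : y <= z -> uact h y <= uact h z by exact: conj_act_homo.
have disj_compl y z w : w <= y -> z <= ~` y -> w `&` z = \bot.
  by move=> wy zy; apply/eqP; rewrite disj_leC (le_trans wy) // lexC.
have fixed y : y <= x -> uact g y = y.
  move=> yx; apply: le_anti; apply/andP; split; apply: le_of.
    (* For z the part of [uact g y] outside y, the preimage of z lies in y and is moved off itself.
       In the other direction, the part of y outside [uact g y] is moved off itself. *)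
    set z := _ `&` _; suff z0 : uact g^-1 z = \bot.
      by rewrite -[z]guVK z0; exact: (conj_act0 H).
    have zy : uact g^-1 z <= y by rewrite -[X in _ <= X]guK mono ?leIl.
    apply: small; first exact: le_trans zy yx.
    by rewrite guVK; apply: disj_compl zy _; rewrite leIr.
  set z := _ `&` _; have zy : z <= y by rewrite leIl.
  apply: small; first exact: le_trans zy yx.
  by rewrite meetC; apply: (@disj_compl (uact g y)); [exact: mono|rewrite leIr].
have gE : unit_val g * iota x = iota x.
  have [|y yE] := @commute_iota_idem _ _ _ _ H (unit_val g * iota x) S_fund.
    move=> y; rewrite -mulgA -(coordI H) (mul_iota H) -/(uact g _) fixed ?leIl //.
    rewrite meetC (coordI H) -mulgA; congr (_ * _).
    by rewrite [RHS](mul_iota H) -/(uact g _) fixed.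
  have iV z : (iota z)^-1 = iota z by exact/idem_inv/(coord_idem H).
  have : iota y * iota y = iota x.
    rewrite -{1}iV -yE invgM iV -mulgA (mulgA _^-1) unit_val_Vmul mul1g.
    exact: coord_idem H x.
  by rewrite (coord_idem H y) yE.
move/fixP: gE; rewrite meet_l // => xbot; by rewrite xbot eqxx in x0.
Qed.

(** The unit is the orthogonal join of s, s^-1 and the idempotent complementary to their domains,
    glued in two steps. *)
Lemma exists_transposition s : dom s `&` rng s = \bot -> exists g,
  [/\ g * g = 1, unit_val g * iota (dom s) = s,
      unit_val g * iota (rng s) = s^-1 &
      forall z, z `&` (dom s `|` rng s) = \bot -> unit_val g * iota z = iota z].
Proof.
move=> sd; set x := dom s; set y := rng s.
have [c [cx cy cxy]] : exists c, [/\ c * iota x = s, c * iota y = s^-1 &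
    c * iota (x `|` y) = c].
  by apply: (glue H S_distr) => //; rewrite ?invgK // meetC.
have rng_c : rng c = x `|` y.
  rewrite -cxy (rng_mul_iota H) (conj_actU H S_distr).
  rewrite -(rng_mul_iota H c x) -(rng_mul_iota H c y) cx cy.
  by rewrite joinC.
have iV z : (iota z)^-1 = iota z by exact/idem_inv/(coord_idem H).
have [u [ux uy uxy]] : exists u, [/\ u * iota (x `|` y) = c,
    u * iota (~` (x `|` y)) = iota (~` (x `|` y)) &
    u * iota ((x `|` y) `|` ~` (x `|` y)) = u].
  apply: (glue H S_distr); rewrite ?meetxC ?iV ?(rng_iota H) //.
    by apply/(mul_iotaP H).
  by rewrite rng_c meetxC.
have uX : u * iota x = s.
  by rewrite -cx -ux -mulgA -(coordI H) meet_r ?leUl.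
have uY : u * iota y = s^-1.
  by rewrite -cy -ux -mulgA -(coordI H) meet_r ?leUr.
have uu : u * u = 1.
  apply: (eq_mul_iotaC H S_distr (x := x `|` y)).
    apply: (eq_mul_iotaU H S_distr).
      rewrite -mulgA uX -{1}(rng_mul H s) mulgA uY mul1g.
      by rewrite -(iota_dom H).
    rewrite -mulgA uY -{1}(rng_mul H s^-1) mulgA uX mul1g.
    by rewrite -(iota_rng H).
  by rewrite -mulgA uy uy mul1g.
have [|g gE] := @unit_val_surj S u; first by exists u.
exists g; split; rewrite ?gE //; first by apply: unit_val_inj; rewrite unit_valM gE uu.
move=> z /eqP; rewrite disj_leC => zxy.
by rewrite -(meet_r zxy) (coordI H) mulgA uy.
Qed.

(** An s with domain below q and range disjoint from q is infinitesimal, and the support of its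
    transposition contains [rng s] and exceeds it only inside q. *)
Lemma covered_supp q x : covered iota q x -> x `&` q = \bot ->
  exists ps : seq (unit_group S), [/\ forall p, p \in ps -> p * p = 1,
    x <= \join_(p <- ps) usupp p & \join_(p <- ps) usupp p <= x `|` q].
Proof.
elim=> [s sq sd|y z _ IHy _ IHz yzq].
  have [|g [gg gx gy gz]] := @exists_transposition s.
    by apply/eqP; rewrite disj_leC (le_trans sq) // lexC -disj_leC sd.
  exists [:: g]; rewrite big_seq1; split.
  - by move=> p; rewrite inE => /eqP->.
  - rewrite -[usupp g]complK -disj_leC; set w := _ `&` _.
    (* The part w of [rng s] fixed by g is also fixed by s^-1, so it lies in [dom s], which is
       disjoint from [rng s]. *)
    have wg : unit_val g * iota w = iota w.
      by apply/fixP; rewrite -meetA [~` _ `&` _]meetC meetxC meetx0.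
    have wr : w <= rng s by rewrite leIl.
    have wE : s^-1 * iota w = iota w.
      by rewrite -gy -mulgA -(coordI H) (meet_r wr).
    have wd : w <= dom s.
      have := conj_act_le_rng H s^-1 w.
      by rewrite -(rng_mul_iota H) wE (rng_iota H).
    rewrite -lex0 -sd lexI wr (le_trans wd) //.
  - set z := dom s `|` rng s in gz.
    have zg : ~` z `&` usupp g = \bot by apply/fixP/gz; rewrite meetC meetxC.
    have -> : usupp g = z `&` usupp g.
      by rewrite -[LHS]meet1x -(joinxC z) meetUl zg joinx0.
    by rewrite (le_trans (leIl _ _)) // leUx leUl andbT (le_trans sq) // leUr.
have [yq zq] : y `&` q = \bot /\ z `&` q = \bot.
  by split; apply/eqP; rewrite -lex0 -yzq leI2 ?leUl ?leUr.
have [ps [pp py ypq]] := IHy yq; have [ps' [pp' pz zpq]] := IHz zq.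
exists (ps ++ ps'); rewrite big_cat; split.
- by move=> p; rewrite mem_cat => /orP[/pp|/pp'].
- by rewrite leU2.
- by rewrite leUx (le_trans ypq) ?(le_trans zpq) // leU2 ?leUl ?leUr.
Qed.

(** Split x into disjoint nonzero y and z. Each is covered by supports of involutions that spill
    over only into the other, so all these supports stay below x. *)
Lemma uact_cover x : exists ps : seq (unit_group S),
  (forall p, p \in ps -> p * p = 1) /\ x = \join_(p <- ps) usupp p.
Proof.
have [->|x0] := eqVneq x \bot; first by exists [::]; rewrite big_nil.
have [y [yx y0 z0]] := exists_split H S_distr S_fund S_simp S_inf x0.
set z := _ `&` _ in z0.
have yz : y `&` z = \bot by rewrite /z meetCA meetxC meetx0.
have xE : y `|` z = x.
  by rewrite /z joinIr joinxC meetx1 join_r.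
have [ps [pp yp py]] := covered_supp (all_covered H S_distr y S_simp z0) yz.
rewrite meetC in yz.
have [ps' [pp' zp pz]] := covered_supp (all_covered H S_distr z S_simp y0) yz.
exists (ps ++ ps'); split.
  by move=> p; rewrite mem_cat => /orP[/pp|/pp'].
rewrite xE in py; rewrite joinC xE in pz.
by rewrite big_cat; apply: le_anti; rewrite leUx py pz -[X in X <= _]xE leU2.
Qed.

(** The unit r is the transposition of the infinitesimal [unit_val p * iota x]; it agrees with p on
    [uact p x] too because p is its own inverse. *)
Lemma uact_restr p x : p * p = 1 -> x `&` uact p x = \bot ->
  exists r, (forall y, y <= x `|` uact p x -> uact r y = uact p y) /\
    (forall y, y `&` (x `|` uact p x) = \bot -> uact r y = y).
Proof.
move=> pp xd; pose s := unit_val p * iota x.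
have dom_s : dom s = x.
  rewrite (dom_mul_iota H) -[RHS]meet1x; congr (_ `&` _).
  by apply: (coord_inj H); rewrite (iota_dom H) unit_val_Vmul (coord1 H).
have rng_s : rng s = uact p x by rewrite (rng_mul_iota H).
have [|r [rr rx ry rz]] := @exists_transposition s; first by rewrite dom_s rng_s.
rewrite dom_s in rx rz; rewrite rng_s in ry rz.
have pV : (unit_val p)^-1 = unit_val p by rewrite -unit_valV (mulg1_eq pp).
have rE : unit_val r * iota (x `|` uact p x) = unit_val p * iota (x `|` uact p x).
  apply: (eq_mul_iotaU H S_distr) => //.
  rewrite ry invgM pV idem_inv; last exact: coord_idem H x.
  by rewrite [RHS](mul_iota H) -/(uact p _) -uactM pp uact1.
exists r; split=> y yd; last by apply/uact_fix/fixP/rz.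
rewrite /uact -(rng_mul_iota H (unit_val r)) -(rng_mul_iota H (unit_val p)).
by rewrite -(meet_r yd) (coordI H) !mulgA rE.
Qed.

Theorem unit_group_locally_moving : locally_moving uact usupp.
Proof.
split.
- exact: uact1.
- exact: uactM.
- by move=> g x y; exact: (conj_act_homo H).
- exact: uact_inj.
- exact: uact_fix.
- exact: uact_moves.
- exact: uact_restr.
- exact: uact_cover.
Qed.

End UnitAction.

(** * From the idempotents back to the monoid *)

Section Lifting.
Context d d' (B : ctbDistrLatticeType d) (B' : ctbDistrLatticeType d').
Variables (S T : inverseMonoid0Type) (iota : B -> S) (iota' : B' -> T).
Hypotheses (H : idempotent_coords iota) (H' : idempotent_coords iota').
Hypotheses (S_distr : distributive_inverse_monoid S).
Hypotheses (T_distr : distributive_inverse_monoid T).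
Hypotheses (S_fund : fundamental S) (S_simp : zero_simplifying S).
Hypothesis S_inf : ~ finite_set [set: S].
Variable theta : B -> B'.
Hypothesis theta_bij : bijective theta.
Hypothesis theta_le : forall x y, (theta x <= theta y) = (x <= y).
Hypothesis theta_unit : forall g : unit_group S, exists h : unit_group T,
  forall x, theta (uact iota g x) = uact iota' h (theta x).

Local Notation act := (conj_act iota).
Local Notation act' := (conj_act iota').
Local Notation dom s := (act s^-1 \top).
Local Notation rng s := (act s \top).

Let theta_surj y : exists x, y = theta x.
Proof. by have [eta _ etaK] := theta_bij; exists (eta y). Qed.

Let thetaI x y : theta (x `&` y) = theta x `&` theta y.
Proof.
have [z zE] := theta_surj (theta x `&` theta y).
have zx : theta z <= theta x by rewrite -zE leIl.
have zy : theta z <= theta y by rewrite -zE leIr.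
apply: le_anti; rewrite lexI !theta_le leIl leIr zE theta_le lexI.
by rewrite -2!theta_le zx theta_le -theta_le zy.
Qed.

Let thetaU x y : theta (x `|` y) = theta x `|` theta y.
Proof.
have [z zE] := theta_surj (theta x `|` theta y).
have xz : theta x <= theta z by rewrite -zE leUl.
have yz : theta y <= theta z by rewrite -zE leUr.
rewrite !theta_le in xz yz.
by apply: le_anti; rewrite [X in _ && X]leUx !theta_le leUl leUr zE theta_le leUx xz yz.
Qed.

Let theta0 : theta \bot = \bot.
Proof.
by have [z zE] := theta_surj \bot; apply: le_anti; rewrite le0x andbT zE theta_le le0x.
Qed.

Let theta1 : theta \top = \top.
Proof.
by have [z zE] := theta_surj \top; apply: le_anti; rewrite lex1 /= zE theta_le lex1.
Qed.

Definition lifts s t := forall x, theta (act s x) = act' t (theta x).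
Definition liftable s := exists t, lifts s t.

Let liftableM s1 s2 : liftable s1 -> liftable s2 -> liftable (s1 * s2).
Proof.
move=> [t1 l1] [t2 l2]; exists (t1 * t2) => x.
by rewrite (conj_actM H) l1 l2 (conj_actM H').
Qed.

Let liftable_unit g : liftable (unit_val g).
Proof. by have [h hP] := theta_unit g; exists (unit_val h). Qed.

Let liftable_iota x : liftable (iota x).
Proof.
by exists (iota' (theta x)) => y; rewrite (conj_act_iota H) (conj_act_iota H') thetaI.
Qed.

(** Restricted to [theta x] and [theta y], the two lifts have disjoint domains, and disjoint ranges
    because [act s] preserves meets; [glue] joins them in T. *)
Let liftable_glue s x y : x `&` y = \bot -> liftable (s * iota x) ->
  liftable (s * iota y) -> liftable (s * iota (x `|` y)).
Proof.
move=> xy [a aP] [b bP].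
have aE z : act' (a * iota' (theta x)) (theta z) = theta (act s (x `&` z)).
  rewrite (conj_actM H') (conj_act_iota H') -thetaI -aP (conj_actM H).
  by rewrite (conj_act_iota H) meetA meetxx.
have bE z : act' (b * iota' (theta y)) (theta z) = theta (act s (y `&` z)).
  rewrite (conj_actM H') (conj_act_iota H') -thetaI -bP (conj_actM H).
  by rewrite (conj_act_iota H) meetA meetxx.
have [c [cx cy cxy]] : exists c, [/\ c * iota' (theta x) = a * iota' (theta x),
    c * iota' (theta y) = b * iota' (theta y) &
    c * iota' (theta x `|` theta y) = c].
  apply: (glue H' T_distr).
  - by rewrite -thetaI xy theta0.
  - by rewrite (dom_mul_iota H') leIr.
  - by rewrite (dom_mul_iota H') leIr.
  - rewrite -theta1 aE bE -thetaI -(conj_actI H) !meetx1 xy (conj_act0 H).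
    exact: theta0.
exists c => z; rewrite -cxy !(conj_actM H) !(conj_actM H').
rewrite (conj_act_iota H) (conj_act_iota H') !meetUl (conj_actU H S_distr).
rewrite (conj_actU H' T_distr) thetaU -aE -bE -cx -cy.
by rewrite !(conj_actM H') !(conj_act_iota H').
Qed.

Let liftable_join a b c : is_join a b c -> liftable a -> liftable b -> liftable c.
Proof.
move=> /(join_dom H S_distr)[aE bE cE] la lb.
set x := dom a in aE cE; set y := dom b in bE cE.
(* Only the part of y outside x is added, which makes the two domains disjoint. *)
have xyE : x `|` y = x `|` (y `&` ~` x) by rewrite joinIr joinxC meetx1.
rewrite cE xyE; apply: liftable_glue.
- by rewrite meetCA meetxC meetx0.
- by rewrite -aE.
- by rewrite (coordI H) mulgA -bE; apply: liftableM => //; exact: liftable_iota.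
Qed.

(** An infinitesimal is the restriction of its transposition, hence a unit times an idempotent. *)
Let liftable_disj x s : dom s <= x -> rng s <= ~` x -> liftable s.
Proof.
move=> sx sCx; have [|g [_ <- _ _]] := exists_transposition H S_distr (s := s).
  by apply/eqP; rewrite disj_leC (le_trans sx) // lexC.
by apply: liftableM; [exact: liftable_unit | exact: liftable_iota].
Qed.

Let rng_mul_le s t : rng (s * t) <= rng s.
Proof. by rewrite (conj_actM H) (conj_act_le_rng H). Qed.

(* With x the range of t, whose domain is below q, the factors t and
   t^-1 * s * iota (~` q) are both infinitesimal. *)
Let liftable_corner q x s : q != \bot -> x <= ~` q ->
  liftable (iota x * s * iota (~` q)).
Proof.
move=> q0 xq; have := all_covered H S_distr x S_simp q0.
have domC u : dom (u * iota (~` q)) <= ~` q by rewrite (dom_mul_iota H) leIr.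
move=> cx; elim: cx xq => [t tq|y z _ IHy _ IHz] xq.
  rewrite (iota_rng H) -!mulgA; apply: liftableM.
    by apply: (@liftable_disj q).
  apply: (@liftable_disj (~` q)); first by rewrite !mulgA.
  by rewrite complK (le_trans (rng_mul_le _ _)).
apply: (@liftable_join (iota y * s * iota (~` q)) (iota z * s * iota (~` q))).
- by have [_ m] := S_distr; apply m; apply m; apply: (coordU H).
- by apply: IHy; apply: le_trans xq; rewrite leUl.
- by apply: IHz; apply: le_trans xq; rewrite leUr.
Qed.

(** For z nonzero, the restriction of s to the complement of z splits into a part with range in z,
    which is infinitesimal, and a part with range off z, settled by [liftable_corner]. Taking for z
    both y and its complement recovers s. *)
Lemma all_liftable s : liftable s.
Proof.
have top0 : \top != \bot :> B.
  apply/eqP => top0; apply: S_inf; apply: sub_finite_set (finite_set1 zerog) => t _ /=.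
  by rewrite -[t]mulg1 -(coord1 H) top0 (coord0 H) mulg0.
have [y [_ y0]] := exists_split H S_distr S_fund S_simp S_inf top0.
rewrite meet1x => Cy0.
have m t x : is_join (iota x * t) (iota (~` x) * t) t.
  have [_ m] := S_distr; rewrite -{3}[t]mul1g -(coord1 H) -(joinxC x).
  by apply m; apply: (coordU H).
have half z : z != \bot -> liftable (s * iota (~` z)).
  move=> z0; apply: liftable_join (m (s * iota (~` z)) z) _ _.
    apply: (@liftable_disj (~` z)); first by rewrite mulgA (dom_mul_iota H) leIr.
    by rewrite complK (conj_actM H) (conj_act_iota H) leIl.
  by rewrite mulgA; apply: liftable_corner.
have : is_join (s * iota y) (s * iota (~` y)) s.
  by have := join_mul_iota H S_distr s y (~` y); rewrite joinxC (coord1 H) mulg1.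
move=> /liftable_join; apply; last exact: half.
by rewrite -[y]complK; apply: half.
Qed.

End Lifting.

(** * Isomorphisms of the monoids and of their unit groups *)

Lemma isomorphicP (M N : baseUMagmaType) (f : M -> N) :
  f 1 = 1 -> {morph f : x y / x * y} -> bijective f -> isomorphic M N.
Proof.
move=> f1 fM f_bij.
pose mM := isUMagmaMorphism.Build M N f (f1, fM).
pose F : UMagmaMorphism.type M N := HB.pack f mM.
by exists F.
Qed.

Lemma isomorphic_units (S T : inverseMonoidType) :
  isomorphic S T -> isomorphic (unit_group S) (unit_group T).
Proof.
move=> [f [k fK kK]].
have kM : {morph k : x y / x * y} := can2_gmulfM fK kK.
have k1 : k 1 = 1 := can2_gmulf1 fK kK.
have f_unit g : units T (f (unit_val g)).
  have [y [gy yg]] := unit_valP g; exists (f y).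
  by rewrite -!gmulfM gy yg gmulf1.
have k_unit g : units S (k (unit_val g)).
  have [y [gy yg]] := unit_valP g; exists (k y).
  by rewrite -!kM gy yg k1.
pose F g : unit_group T := SigSub (mem_set (f_unit g)).
pose K g : unit_group S := SigSub (mem_set (k_unit g)).
have FE g : unit_val (F g) = f (unit_val g) by [].
have KE g : unit_val (K g) = k (unit_val g) by [].
apply: (@isomorphicP _ _ F).
- by apply: unit_val_inj; rewrite FE !unit_val1 gmulf1.
- by move=> g h; apply: unit_val_inj; rewrite unit_valM !FE unit_valM gmulfM.
exists K => g; apply: unit_val_inj; first by rewrite KE FE fK.
by rewrite FE KE kK.
Qed.

Lemma countably_infinite_not_finite (X : Type) :
  countably_infinite X -> ~ finite_set [set: X].
Proof. by move=> X_nat; rewrite (eq_finite_set X_nat); exact: infinite_nat. Qed.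

Theorem theorem1p2 (S T : inverseMonoid0Type)
    (S_cnt : countably_infinite S) (T_cnt : countably_infinite T)
    (S_bool : boolean_inverse_meet_monoid S)
    (T_bool : boolean_inverse_meet_monoid T)
    (S_simp : zero_simplifying S) (T_simp : zero_simplifying T)
    (S_fund : fundamental S) (T_fund : fundamental T) :
  isomorphic S T <-> isomorphic (unit_group S) (unit_group T).
Proof.
split; first exact: isomorphic_units.
move=> [f f_bij].
have S_inf := countably_infinite_not_finite S_cnt.
have T_inf := countably_infinite_not_finite T_cnt.
have [S_bim S_meet] := S_bool; have [T_bim T_meet] := T_bool.
have [S_distr _] := S_bim; have [T_distr _] := T_bim.
have [d [B [iota H]]] := idempotent_coordsP S_bim.
have [d' [B' [iota' H']]] := idempotent_coordsP T_bim.
have LS := unit_group_locally_moving H S_distr S_meet S_fund S_simp S_inf.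
have LT := unit_group_locally_moving H' T_distr T_meet T_fund T_simp T_inf.
have [theta [theta_bij theta_le theta_act]] := spatial_isomorphism LS LT f_bij.
have [eta thetaK etaK] := theta_bij; have [k fK kK] := f_bij.
have /choice[F FP] s := all_liftable H H' S_distr T_distr S_fund S_simp S_inf
  theta_bij theta_le (fun g => ex_intro _ (f g) (theta_act g)) s.
(* Lifting also runs from T to S, along the inverse [eta], which is equivariant for the inverse of
   f. *)
have eta_act h x' : eta (uact iota' h x') = uact iota (k h) (eta x').
  by rewrite -{1}(kK h) -{1}(etaK x') -theta_act thetaK.
have eta_le x' y' : (eta x' <= eta y') = (x' <= y').
  by rewrite -theta_le !etaK.
have /choice[K KP] t := all_liftable H' H T_distr S_distr T_fund T_simp T_inf
  (Bijective etaK thetaK) eta_le (fun h => ex_intro _ (k h) (eta_act h)) t.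
(* Uniqueness of lifts makes F multiplicative, since a product of lifts lifts the product. *)
have lifts_uniq s t t' :
  lifts iota iota' theta s t -> lifts iota iota' theta s t' -> t = t'.
  move=> st st'; apply: (conj_act_inj H' T_fund) => x'.
  by rewrite -(etaK x') -st st'.
apply: (@isomorphicP _ _ F).
- by apply: (lifts_uniq 1) => // x; rewrite (conj_act1 H) (conj_act1 H').
- move=> s t; apply: lifts_uniq (FP _) _ => x.
  by rewrite (conj_actM H) !FP (conj_actM H').
exists K => [s|t].
  (* K (F s) and s have the same action on B, so they are equal as S is fundamental. *)
  apply: (conj_act_inj H S_fund) => x.
  by rewrite -{1}(thetaK x) -KP -FP thetaK.
apply: (conj_act_inj H' T_fund) => x'.
by rewrite -{1}(etaK x') -FP -KP etaK.
Qed.
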